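(* Let $t_0\in\mathbb{R}$ and let $b,k:[t_0,\infty)\to\mathbb{R}$ be continuous functions with $b(t)\le 0$ and $k(t)\le 0$ for all $t\ge t_0$. Then the zero solution of $u''(t)+b(t)u'(t)+k(t)u(t)=0$ on $[t_0,\infty)$ is unstable.
   Context: The zero solution of the second-order equation is called stable if for each $\epsilon>0$ there exists $\delta=\delta(\epsilon,t_0)>0$ such that every solution $u$ on $[t_0,\infty)$ with $u(t_0)^2+u'(t_0)^2<\delta^2$ satisfies $u(t)^2+u'(t)^2<\epsilon^2$ for all $t\ge t_0$. It is called unstable if it is not stable. The initial time $t_0$ is fixed. *)

(* Defs.v *)
From Stdlib Require Import Reals.
Open Scope R_scope.

Definition half_line (t0 : R) : R -> Prop := fun t => t0 <= t.

(* Functions on [t0, +oo) are represented by total functions R -> R of which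
   only the values on [t0, +oo) are ever used: [continue_in] and [D_in] are
   continuity and differentiability relative to the domain, hence one-sided
   at t0. *)
Definition continuous_from (t0 : R) (f : R -> R) : Prop :=
  forall t, t0 <= t -> continue_in f (half_line t0) t.

Definition derivative_from (t0 : R) (f f' : R -> R) : Prop :=
  forall t, t0 <= t -> D_in f f' (half_line t0) t.

(* The argument u' is the derivative of u; it is determined by u on
   [t0, +oo). *)
Definition is_solution (t0 : R) (b k u u' : R -> R) : Prop :=
  derivative_from t0 u u' /\
  exists u'' : R -> R,
    derivative_from t0 u' u'' /\
    forall t, t0 <= t -> u'' t + b t * u' t + k t * u t = 0.

Definition zero_stable (t0 : R) (b k : R -> R) : Prop :=
  forall eps, 0 < eps ->
  exists delta, 0 < delta /\
    forall u u' : R -> R,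
      is_solution t0 b k u u' ->
      u t0 ^ 2 + u' t0 ^ 2 < delta ^ 2 ->
      forall t, t0 <= t -> u t ^ 2 + u' t ^ 2 < eps ^ 2.

Definition zero_unstable (t0 : R) (b k : R -> R) : Prop :=
  ~ zero_stable t0 b k.

(* Main.v *)
Require Import Defs.
From Stdlib Require Import Reals Lra Lia PSeries_reg.
From Coquelicot Require Import Coquelicot.
Open Scope R_scope.

(** The instability comes from one growing solution. Put [p = - b] and
[q = - k], both nonnegative, so that the equation reads [u'' = p u' + q u],
and take [u(t0) = u'(t0) = c > 0]. The product [w = u u'] satisfies
[w' = u'^2 + p w + q u^2 >= p w], hence [w exp (- P)] is nondecreasing for a
primitive [P] of [p], and since [P] is itself nondecreasing, [w] stays above
its initial value [c^2] ([product_lower_bound]). Therefore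
[(u^2)' = 2 w >= 2 c^2], and [u^2] grows at least linearly
([square_lower_bound]): however small [c] is, [u^2] exceeds [1] at a finite
time. Working with [w] instead of the signs of [u] and [u'] makes any
first-exit-time argument superfluous.

What has to be supplied is that such a solution exists on the whole half
line, which is [linear_system_solution]. The coefficients are extended to the
left of [t0] by constants, and the solution of the resulting linear system on
the real line is the sum of the Picard series, whose terms are iterated
primitives. With [clock] a primitive of [2 (1 + |p| + |q|)], the [n]-th term
is at most a constant times [cosh clock / 2^n] ([picard_term_bound]): the
weight [cosh clock] is chosen so that integrating against the coefficients
gains a factor [1/2] at every step. The series thus converges geometrically,
locally uniformly, together with its derivative, and can be differentiated
term by term ([derivable_pt_lim_geometric_limit]). Since the weight is
continuous on all of the line, no local solutions have to be glued. *)

(** * Calculus on the real line *)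

Definition primitive (a : R) (f : R -> R) (t : R) : R := RInt f a t.

Lemma derivable_pt_lim_primitive (a : R) (f : R -> R) (t : R) :
  continuity f -> derivable_pt_lim (primitive a f) t (f t).
Proof.
  intros hf. apply is_derive_Reals. apply is_derive_RInt with (a := a).
  - apply filter_forall. intros x. apply (RInt_correct f a x).
    apply (ex_RInt_continuous f a x). intros z _.
    apply continuity_pt_filterlim, hf.
  - apply continuity_pt_filterlim, hf.
Qed.

Lemma primitive_base (a : R) (f : R -> R) : primitive a f a = 0.
Proof. apply (RInt_point a f). Qed.

Lemma derivable_continuity (f f' : R -> R) :
  (forall t, derivable_pt_lim f t (f' t)) -> continuity f.
Proof.
  intros h t. apply derivable_continuous_pt. exists (f' t). apply h.
Qed.

Lemma increasing_of_derivative_nonneg (f f' : R -> R) (a b : R) :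
  (forall t, a <= t <= b -> derivable_pt_lim f t (f' t)) ->
  (forall t, a <= t <= b -> 0 <= f' t) ->
  a <= b -> f a <= f b.
Proof.
  intros hd hp [hab | <-]; [| lra].
  destruct (MVT_cor2 f f' a b hab hd) as [c [hc hcab]].
  assert (0 <= f' c) by (apply hp; lra). nra.
Qed.

(** [g - f] and [g + f] are both nondecreasing and vanish at [a]. The absolute
value on the right makes the comparison valid on both sides of [a], where [g]
changes sign. *)
Lemma Rabs_le_of_derivative_Rabs_le (f f' g g' : R -> R) (a : R) :
  (forall t, derivable_pt_lim f t (f' t)) ->
  (forall t, derivable_pt_lim g t (g' t)) ->
  f a = 0 -> g a = 0 ->
  (forall t, Rabs (f' t) <= g' t) ->
  forall t, Rabs (f t) <= Rabs (g t).
Proof.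
  intros hf hg fa ga hle t.
  assert (hm : forall x y, x <= y ->
            g x - f x <= g y - f y /\ g x + f x <= g y + f y).
  { intros x y hxy. split.
    - apply (increasing_of_derivative_nonneg
               (fun s => g s - f s) (fun s => g' s - f' s)); auto.
      + intros s _. now apply derivable_pt_lim_minus.
      + intros s _. specialize (hle s). apply Rabs_le_between in hle. lra.
    - apply (increasing_of_derivative_nonneg
               (fun s => g s + f s) (fun s => g' s + f' s)); auto.
      + intros s _. now apply derivable_pt_lim_plus.
      + intros s _. specialize (hle s). apply Rabs_le_between in hle. lra. }
  destruct (Rle_dec a t) as [hat | hat].
  - destruct (hm a t hat). rewrite (Rabs_pos_eq (g t)) by lra.
    apply Rabs_le_between. lra.
  - destruct (hm t a); [lra |]. rewrite (Rabs_left1 (g t)) by lra.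
    apply Rabs_le_between. lra.
Qed.

Lemma cosh_ge_1 (x : R) : 1 <= cosh x.
Proof.
  unfold cosh. pose proof (exp_ineq1_le x). pose proof (exp_ineq1_le (- x)). lra.
Qed.

Lemma Rabs_sinh_le_cosh (x : R) : Rabs (sinh x) <= cosh x.
Proof.
  unfold sinh, cosh. pose proof (exp_pos x). pose proof (exp_pos (- x)).
  apply Rabs_le_between. lra.
Qed.

(** * Geometrically convergent sequences of functions *)

Lemma pow_half_lt (K eps : R) :
  0 <= K -> 0 < eps ->
  exists N, forall n, (N <= n)%nat -> K * (/ 2) ^ n < eps.
Proof.
  intros hK he.
  destruct (pow_lt_1_zero (/ 2)) with (y := eps / (K + 1)) as [N hN].
  - rewrite Rabs_pos_eq; lra.
  - apply Rdiv_lt_0_compat; lra.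
  - exists N. intros n hn. specialize (hN n hn).
    assert (0 < (/ 2) ^ n) by (apply pow_lt; lra).
    rewrite Rabs_pos_eq in hN by lra.
    apply (Rmult_lt_compat_l (K + 1)) in hN; [| lra].
    replace ((K + 1) * (eps / (K + 1))) with eps in hN by (field; lra). nra.
Qed.

(** The ratio [1/2] makes the tail sum equal to the last dominating term kept,
so the constant is the same as for the terms. *)
Lemma Series_geometric_tail (a : nat -> R) (K : R) :
  (forall n, Rabs (a n) <= K * (/ 2) ^ n) ->
  forall N, Rabs (Series a - sum_f_R0 a N) <= K * (/ 2) ^ N.
Proof.
  intros ha N.
  assert (hg : ex_series (fun n => (/ 2) ^ n)).
  { eexists. apply is_series_geom. rewrite Rabs_pos_eq; lra. }
  assert (hex : ex_series a).
  { apply (ex_series_le (V := R_CompleteNormedModule) a (fun n => K * (/ 2) ^ n));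
      [exact ha | exact (ex_series_scal_l K _ hg)]. }
  rewrite (Series_incr_n a (S N)) by (lia || exact hex). simpl Init.Nat.pred.
  replace (sum_f_R0 a N + _ - sum_f_R0 a N)
    with (Series (fun k => a (S N + k)%nat)) by ring.
  assert (hb : forall k, Rabs (a (S N + k)%nat)
                         <= K * (/ 2) ^ S N * (/ 2) ^ k).
  { intros k. rewrite Rmult_assoc, <- pow_add. apply ha. }
  assert (hs : ex_series (fun k => K * (/ 2) ^ S N * (/ 2) ^ k))
    by exact (ex_series_scal_l (K * (/ 2) ^ S N) _ hg).
  eapply Rle_trans.
  { apply Series_Rabs.
    apply (ex_series_le (V := R_CompleteNormedModule) _ _ (fun k =>
             eq_ind_r (fun x => x <= _) (hb k) (Rabs_Rabsolu _)) hs). }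
  eapply Rle_trans.
  { apply Series_le; [| exact hs]. intros k. split; [apply Rabs_pos | apply hb]. }
  rewrite Series_scal_l, Series_geom by (rewrite Rabs_pos_eq; lra).
  apply Req_le. simpl. field.
Qed.

Lemma Series_eq_head (a : nat -> R) :
  (forall n, a (S n) = 0) -> Series a = a O.
Proof.
  intros ha. apply is_series_unique.
  apply (is_lim_seq_ext (fun _ => a O) (sum_n a) (a O)); [| apply is_lim_seq_const].
  intros n. rewrite sum_n_Reals.
  induction n as [| n IH]; simpl; [reflexivity |].
  rewrite <- IH, ha. ring.
Qed.

(** Continuity of the error factor [E'] bounds it near each point, so the
derivatives converge uniformly there, which is what passing to the limit
requires. *)
Lemma derivable_pt_lim_geometric_limit
  (fn fn' : nat -> R -> R) (f f' E E' : R -> R) :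
  (forall n t, derivable_pt_lim (fn n) t (fn' n t)) ->
  continuity E' ->
  (forall n t, Rabs (f t - fn n t) <= E t * (/ 2) ^ n) ->
  (forall n t, Rabs (f' t - fn' n t) <= E' t * (/ 2) ^ n) ->
  forall t, derivable_pt_lim f t (f' t).
Proof.
  intros hd hE' hf hf' t.
  assert (hE0 : forall (h : R -> R) hn F,
            (forall n t, Rabs (h t - hn n t) <= F t * (/ 2) ^ n) ->
            forall s, 0 <= F s).
  { intros h hn F H s. specialize (H O s). simpl in H.
    pose proof (Rabs_pos (h s - hn O s)). lra. }
  destruct (hE' t 1 Rlt_0_1) as [r [hr hball]].
  apply CVU_derivable with (f := fn) (f' := fn') (c := t) (d := mkposreal r hr).
  - intros eps heps.
    (* The radius [r] was chosen so that [E' y < E' t + 1] on the ball. *)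
    destruct (pow_half_lt (E' t + 1) eps) as [N hN]; [| exact heps |].
    { pose proof (hE0 _ _ _ hf' t). lra. }
    exists N. intros n y hn hy.
    eapply Rle_lt_trans; [apply hf' |].
    eapply Rle_lt_trans; [| apply (hN n hn)].
    apply Rmult_le_compat_r; [apply pow_le; lra |].
    destruct (Req_dec t y) as [<- | hne]; [lra |].
    assert (h := hball y (conj (conj I hne) hy)).
    simpl in h. unfold Rdist in h. apply Rabs_def2 in h. lra.
  - intros x _ eps heps.
    destruct (pow_half_lt (E x) eps) as [N hN]; [| exact heps |].
    { exact (hE0 _ _ _ hf x). }
    exists N. intros n hn. unfold Rdist. rewrite Rabs_minus_sym.
    eapply Rle_lt_trans; [apply hf | now apply hN].
  - intros n x _. apply hd.
  - unfold Boule. simpl. rewrite Rminus_diag, Rabs_R0. exact hr.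
Qed.

(** * Global solutions of linear systems *)

(** Increments of the Picard iteration for [u' = v], [v' = p v + q u],
[u a = c], [v a = d]: by linearity the iterates are the partial sums of these
terms, and the solution is their sum. *)
Fixpoint picard_term (a c d : R) (p q : R -> R) (n : nat) : (R -> R) * (R -> R) :=
  match n with
  | O => (fun _ => c, fun _ => d)
  | S m => let w := picard_term a c d p q m in
           (primitive a (snd w),
            primitive a (fun t => p t * snd w t + q t * fst w t))
  end.

Section LinearSystem.

Variables (a c d : R) (p q : R -> R).
Hypotheses (hp : continuity p) (hq : continuity q).

Let un (n : nat) : R -> R := fst (picard_term a c d p q n).
Let vn (n : nat) : R -> R := snd (picard_term a c d p q n).

Lemma picard_term_continuity (n : nat) : continuity (un n) /\ continuity (vn n).
Proof.
  unfold un, vn. induction n as [| n [IHu IHv]]; simpl.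
  - split; apply continuity_const; intros x y; reflexivity.
  - split; eapply derivable_continuity; intros t;
      apply derivable_pt_lim_primitive.
    + exact IHv.
    + apply (continuity_plus (fun s => p s * _ s) (fun s => q s * _ s));
        now apply continuity_mult.
Qed.

Lemma picard_term_derivative (n : nat) (t : R) :
  derivable_pt_lim (un (S n)) t (vn n t) /\
  derivable_pt_lim (vn (S n)) t (p t * vn n t + q t * un n t).
Proof.
  destruct (picard_term_continuity n) as [hu hv].
  split; simpl.
  - now apply derivable_pt_lim_primitive.
  - apply (derivable_pt_lim_primitive a (fun s => p s * vn n s + q s * un n s)).
    apply (continuity_plus (fun s => p s * vn n s) (fun s => q s * un n s));
      now apply continuity_mult.
Qed.

(** [rate] dominates both components of the right-hand side of the system, and
is at least [1] because of the equation [u' = v]; [clock] is the time scale in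
which the system has Lipschitz constant at most [1/2]. *)
Let rate (t : R) : R := 1 + Rabs (p t) + Rabs (q t).
Let clock (t : R) : R := primitive a (fun s => 2 * rate s) t.
Let size : R := Rabs c + Rabs d.

Lemma rate_continuity : continuity rate.
Proof.
  apply (continuity_plus (fun t => 1 + Rabs (p t)) (fun t => Rabs (q t))).
  - apply (continuity_plus (fun t => 1) (fun t => Rabs (p t))).
    + apply continuity_const. intros x y; reflexivity.
    + apply (continuity_comp p Rabs); [exact hp | exact Rcontinuity_abs].
  - apply (continuity_comp q Rabs); [exact hq | exact Rcontinuity_abs].
Qed.

Lemma clock_derivative (t : R) : derivable_pt_lim clock t (2 * rate t).
Proof.
  apply (derivable_pt_lim_primitive a (fun s => 2 * rate s)).
  apply (continuity_scal rate 2), rate_continuity.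
Qed.

Lemma rate_bounds (t x y B : R) :
  Rabs x <= B -> Rabs y <= B ->
  Rabs x <= rate t * B /\ Rabs (p t * x + q t * y) <= rate t * B.
Proof.
  intros hx hy.
  pose proof (Rabs_pos (p t)). pose proof (Rabs_pos (q t)).
  pose proof (Rabs_pos x). pose proof (Rabs_pos y).
  unfold rate. split; [nra |].
  eapply Rle_trans; [apply Rabs_triang |]. rewrite !Rabs_mult. nra.
Qed.

(** Since [cosh clock * 2 rate] is the derivative of [sinh clock] and
[|sinh| <= cosh], integrating the bound for step [n] returns the same weight
with an additional factor [1/2]. *)
Lemma picard_term_bound (n : nat) (t : R) :
  Rabs (un n t) <= size * cosh (clock t) * (/ 2) ^ n /\
  Rabs (vn n t) <= size * cosh (clock t) * (/ 2) ^ n.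
Proof.
  revert t. induction n as [| n IH]; intros t.
  - unfold un, vn, size. simpl. pose proof (cosh_ge_1 (clock t)).
    pose proof (Rabs_pos c). pose proof (Rabs_pos d). nra.
  - assert (hC : 0 <= size * (/ 2) ^ S n).
    { apply Rmult_le_pos; [| apply pow_le; lra]. unfold size.
      pose proof (Rabs_pos c). pose proof (Rabs_pos d). lra. }
    set (g := fun s => size * (/ 2) ^ S n * sinh (clock s)).
    assert (hg : forall s, derivable_pt_lim g s
                   (size * (/ 2) ^ S n * (cosh (clock s) * (2 * rate s)))).
    { intros s. apply (derivable_pt_lim_scal (fun r => sinh (clock r))).
      apply (derivable_pt_lim_comp clock sinh);
        [apply clock_derivative | apply derivable_pt_lim_sinh]. }
    assert (hga : g a = 0).
    { unfold g, clock. rewrite primitive_base, sinh_0. ring. }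
    assert (hgt : Rabs (g t) <= size * cosh (clock t) * (/ 2) ^ S n).
    { unfold g. rewrite Rabs_mult, (Rabs_pos_eq _ hC).
      pose proof (Rabs_sinh_le_cosh (clock t)). nra. }
    assert (hM : forall s,
      size * (/ 2) ^ S n * (cosh (clock s) * (2 * rate s))
      = rate s * (size * cosh (clock s) * (/ 2) ^ n)) by (intros s; simpl; field).
    split; (eapply Rle_trans; [| exact hgt]).
    + apply (Rabs_le_of_derivative_Rabs_le _ _ _ _ a
               (fun s => proj1 (picard_term_derivative n s)) hg);
        [apply primitive_base | exact hga |].
      intros s. rewrite hM. apply (rate_bounds s _ (un n s)); apply IH.
    + apply (Rabs_le_of_derivative_Rabs_le _ _ _ _ a
               (fun s => proj2 (picard_term_derivative n s)) hg);
        [apply primitive_base | exact hga |].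
      intros s. rewrite hM. apply rate_bounds; apply IH.
Qed.

(** A linear system has no blow-up: the solution with given data at [a] exists
on the whole line, as the sum of the Picard series. *)
Lemma linear_system_solution :
  exists u v : R -> R,
    (forall t, derivable_pt_lim u t (v t)) /\
    (forall t, derivable_pt_lim v t (p t * v t + q t * u t)) /\
    u a = c /\ v a = d.
Proof.
  set (SU := fun N t => sum_f_R0 (fun n => un n t) N).
  set (SV := fun N t => sum_f_R0 (fun n => vn n t) N).
  set (u := fun t => Series (fun n => un n t)).
  set (v := fun t => Series (fun n => vn n t)).
  set (E := fun t => size * cosh (clock t)).
  assert (hu : forall N t, Rabs (u t - SU N t) <= E t * (/ 2) ^ N).
  { intros N t. apply Series_geometric_tail. intros n. apply picard_term_bound. }
  assert (hv : forall N t, Rabs (v t - SV N t) <= E t * (/ 2) ^ N).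
  { intros N t. apply Series_geometric_tail. intros n. apply picard_term_bound. }
  assert (hE0 : forall t, 0 <= E t).
  { intros t. unfold E, size. pose proof (cosh_ge_1 (clock t)).
    pose proof (Rabs_pos c). pose proof (Rabs_pos d). nra. }
  assert (hE : continuity E).
  { apply (continuity_scal (fun t => cosh (clock t)) size).
    apply (continuity_comp clock cosh).
    - apply (derivable_continuity _ _ clock_derivative).
    - apply (derivable_continuity _ _ derivable_pt_lim_cosh). }
  assert (hME : continuity (fun t => rate t * E t))
    by (apply (continuity_mult rate E); [exact rate_continuity | exact hE]).
  (* Differentiating a term lowers its index, whence the shift from [S N] to
     [N]; the initial term is constant. *)
  assert (hSU : forall N t, derivable_pt_lim (SU (S N)) t (SV N t)).
  { intros N t. induction N as [| N IH].
    - replace (SV O t) with (0 + vn 0 t) by (unfold SV; simpl; ring).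
      apply (derivable_pt_lim_plus (un 0) (un 1)).
      + apply derivable_pt_lim_const.
      + exact (proj1 (picard_term_derivative 0 t)).
    - apply (derivable_pt_lim_plus (SU (S N)) (un (S (S N)))); [exact IH |].
      exact (proj1 (picard_term_derivative (S N) t)). }
  assert (hSV : forall N t,
    derivable_pt_lim (SV (S N)) t (p t * SV N t + q t * SU N t)).
  { intros N t. induction N as [| N IH].
    - replace (p t * SV O t + q t * SU O t)
        with (0 + (p t * vn 0 t + q t * un 0 t)) by (unfold SU, SV; simpl; ring).
      apply (derivable_pt_lim_plus (vn 0) (vn 1)).
      + apply derivable_pt_lim_const.
      + exact (proj2 (picard_term_derivative 0 t)).
    - replace (p t * SV (S N) t + q t * SU (S N) t)
        with (p t * SV N t + q t * SU N t
              + (p t * vn (S N) t + q t * un (S N) t))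
        by (unfold SU, SV; simpl; ring).
      apply (derivable_pt_lim_plus (SV (S N)) (vn (S (S N)))); [exact IH |].
      exact (proj2 (picard_term_derivative (S N) t)). }
  assert (hhalf : forall N t, E t * (/ 2) ^ S N <= E t * (/ 2) ^ N).
  { intros N t. assert (0 < (/ 2) ^ N) by (apply pow_lt; lra).
    specialize (hE0 t). simpl. nra. }
  exists u, v. repeat split.
  - apply (derivable_pt_lim_geometric_limit (fun N => SU (S N)) SV u v E E);
      auto.
    intros N t. eapply Rle_trans; [apply hu | apply hhalf].
  - apply (derivable_pt_lim_geometric_limit (fun N => SV (S N))
             (fun N t => p t * SV N t + q t * SU N t) v
             (fun t => p t * v t + q t * u t) E (fun t => rate t * E t)); auto.
    + intros N t. eapply Rle_trans; [apply hv | apply hhalf].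
    + intros N t.
      replace (p t * v t + q t * u t - (p t * SV N t + q t * SU N t))
        with (p t * (v t - SV N t) + q t * (u t - SU N t)) by ring.
      rewrite Rmult_assoc. apply rate_bounds; auto.
  - apply (Series_eq_head (fun n => un n a)). intros n. apply primitive_base.
  - apply (Series_eq_head (fun n => vn n a)). intros n. apply primitive_base.
Qed.

End LinearSystem.

(** * Growth of solutions *)

(** Constant extension to the left: [Rmax a] is 1-Lipschitz, so continuity
relative to the half line becomes continuity on the line. *)
Lemma continuity_extend_left (a : R) (f : R -> R) :
  continuous_from a f -> continuity (fun t => f (Rmax a t)).
Proof.
  intros hf t eps heps.
  destruct (hf (Rmax a t) (Rmax_l a t) eps heps) as [r [hr h]].
  exists r. split; [exact hr |].
  intros x [_ hx]. simpl in *. unfold Rdist in *.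
  destruct (Req_dec (Rmax a t) (Rmax a x)) as [e | hne].
  - rewrite e, Rminus_diag, Rabs_R0. exact heps.
  - apply h. split.
    + split; [apply Rmax_l | exact hne].
    + eapply Rle_lt_trans; [| exact hx].
      unfold Rmax. destruct (Rle_dec a x), (Rle_dec a t);
        unfold Rabs; repeat destruct Rcase_abs; lra.
Qed.

(** Multiplying [(u v)' = v^2 + p u v + q u^2] by the integrating factor
[exp (- P)] leaves the nonnegative derivative [exp (- P) (v^2 + q u^2)]; the
factor is [1] at [a] and at most [1] afterwards. *)
Lemma product_lower_bound (a : R) (p q u v : R -> R) :
  continuity p ->
  (forall t, derivable_pt_lim u t (v t)) ->
  (forall t, derivable_pt_lim v t (p t * v t + q t * u t)) ->
  (forall t, 0 <= p t) -> (forall t, 0 <= q t) ->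
  0 <= u a * v a ->
  forall t, a <= t -> u a * v a <= u t * v t.
Proof.
  intros hpc hu hv hp hq h0 t hat.
  set (P := primitive a p).
  assert (hP : forall s, derivable_pt_lim P s (p s))
    by (intros s; now apply derivable_pt_lim_primitive).
  assert (hPa : P a = 0) by apply primitive_base.
  assert (hPt : 0 <= P t).
  { rewrite <- hPa. apply (increasing_of_derivative_nonneg P p); auto. }
  assert (hmono : u a * v a * exp (- P a) <= u t * v t * exp (- P t)).
  { apply (increasing_of_derivative_nonneg
      (fun s => u s * v s * exp (- P s))
      (fun s => exp (- P s) * (v s ^ 2 + q s * u s ^ 2))); auto.
    - intros s _.
      replace (exp (- P s) * (v s ^ 2 + q s * u s ^ 2))
        with ((v s * v s + u s * (p s * v s + q s * u s)) * exp (- P s)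
              + u s * v s * (exp (- P s) * - p s)) by ring.
      apply (derivable_pt_lim_mult (fun r => u r * v r) (fun r => exp (- P r))).
      + now apply (derivable_pt_lim_mult u v).
      + apply (derivable_pt_lim_comp (fun r => - P r) exp).
        * now apply (derivable_pt_lim_opp P).
        * apply derivable_pt_lim_exp.
    - intros s _. pose proof (exp_pos (- P s)).
      apply Rmult_le_pos; [lra |]. specialize (hq s). nra. }
  rewrite hPa, Ropp_0, exp_0, Rmult_1_r in hmono.
  assert (exp (- P t) <= 1).
  { rewrite <- exp_0. destruct hPt as [h | <-]; [| rewrite Ropp_0; lra].
    left. apply exp_increasing. lra. }
  pose proof (exp_pos (- P t)). nra.
Qed.

Lemma square_lower_bound (a m : R) (u v : R -> R) :
  (forall t, derivable_pt_lim u t (v t)) ->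
  (forall t, a <= t -> m <= u t * v t) ->
  forall t, a <= t -> 2 * m * (t - a) <= u t ^ 2.
Proof.
  intros hu hm t hat.
  assert (h : u a * u a - 2 * m * (a - a) <= u t * u t - 2 * m * (t - a)).
  { apply (increasing_of_derivative_nonneg
             (fun s => u s * u s - 2 * m * (s - a))
             (fun s => v s * u s + u s * v s - 2 * m * (1 - 0))); auto.
    - intros s _.
      apply (derivable_pt_lim_minus (fun r => u r * u r)
               (fun r => 2 * m * (r - a))).
      + now apply (derivable_pt_lim_mult u u).
      + apply (derivable_pt_lim_scal (fun r => r - a)).
        apply (derivable_pt_lim_minus (fun r => r) (fun _ => a)).
        * apply derivable_pt_lim_id.
        * apply derivable_pt_lim_const.
    - intros s hs. specialize (hm s (proj1 hs)). lra. }
  nra.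
Qed.

Lemma derivative_from_of_derivable (a : R) (f f' : R -> R) :
  (forall t, derivable_pt_lim f t (f' t)) -> derivative_from a f f'.
Proof.
  intros h t _. apply (D_in_imp f f' no_cond); [intros x _; exact I |].
  apply derivable_pt_lim_D_in, h.
Qed.

Theorem theorem4p1 (t0 : R) (b k : R -> R)
  (hb : continuous_from t0 b) (hk : continuous_from t0 k)
  (hb0 : forall t, t0 <= t -> b t <= 0)
  (hk0 : forall t, t0 <= t -> k t <= 0) :
  zero_unstable t0 b k.
Proof.
  intros hstable.
  destruct (hstable 1 Rlt_0_1) as [delta [hdelta hsmall]].
  set (p := fun t => - b (Rmax t0 t)). set (q := fun t => - k (Rmax t0 t)).
  assert (hp : continuity p) by now apply continuity_opp, continuity_extend_left.
  assert (hq : continuity q) by now apply continuity_opp, continuity_extend_left.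
  assert (hp0 : forall t, 0 <= p t).
  { intros t. specialize (hb0 _ (Rmax_l t0 t)). unfold p. lra. }
  assert (hq0 : forall t, 0 <= q t).
  { intros t. specialize (hk0 _ (Rmax_l t0 t)). unfold q. lra. }
  (* [c^2 + c^2 = delta^2 / 2] keeps the initial data inside the ball. *)
  set (c := delta / 2). assert (hc : 0 < c * c) by (unfold c; nra).
  destruct (linear_system_solution t0 c c p q hp hq) as (u & v & hu & hv & u0 & v0).
  assert (hsol : is_solution t0 b k u v).
  { split; [now apply derivative_from_of_derivable |].
    exists (fun t => p t * v t + q t * u t).
    split; [now apply derivative_from_of_derivable |].
    intros t ht. unfold p, q. rewrite Rmax_right by exact ht. ring. }
  assert (hinit : u t0 ^ 2 + v t0 ^ 2 < delta ^ 2)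
    by (rewrite u0, v0; unfold c; nra).
  assert (hprod : forall t, t0 <= t -> c * c <= u t * v t).
  { intros t ht. rewrite <- u0 at 1. rewrite <- v0 at 1.
    apply (product_lower_bound t0 p q u v); auto. rewrite u0, v0. lra. }
  (* The time at which the lower bound [2 c^2 (t - t0)] for [u^2] reaches 1. *)
  set (t := t0 + / (2 * (c * c))).
  assert (ht : t0 <= t).
  { assert (0 < / (2 * (c * c))) by (apply Rinv_0_lt_compat; lra). unfold t. lra. }
  assert (hlarge := square_lower_bound t0 (c * c) u v hu hprod t ht).
  replace (2 * (c * c) * (t - t0)) with 1 in hlarge
    by (unfold t; field; intros e; rewrite e in hc; lra).
  specialize (hsmall u v hsol hinit t ht).
  pose proof (pow2_ge_0 (v t)). lra.
Qed.
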